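(* Let $(V,\omega)$ be a vertex operator algebra and let $\omega'$ be any conformal vector of $V$, so that $(V,\omega')$ is a conformal vertex algebra. Assume that $W_2,W_3$ are weak $(V,\omega)$-modules and $W_1$ is a lowest weight weak $(V,\omega)$-module. Then there is a canonical (linear) isomorphism between the space of intertwining operators with respect to $\omega$ of type $\binom{W_3}{W_1W_2}$ and the space of intertwining operators with respect to $\omega'$ of the same type.
   Context: All vector spaces are over $\mathbb{C}$; $\mathbb{N}=\{0,1,2,\dots\}$; $\delta(x)=\sum_{n\in\mathbb{Z}}x^n$. A conformal vector of a vertex algebra $V$ (vacuum $\mathbf{1}$, $\mathcal{D}v=v_{-2}\mathbf{1}$) is a vector $\omega\in V$ such that, with $Y(\omega,x)=\sum_{n}L(n)x^{-n-2}$, $[L(m),L(n)]=(m-n)L(m+n)+\frac1{12}(m^3-m)\delta_{m+n,0}c$ for some $c\in\mathbb{C}$, $L(-1)=\mathcal{D}$, $L(0)$ is semisimple, and $L(n)$ for $n\ge1$ are locally nilpotent; $(V,\omega)$ is then a conformal vertex algebra (conformal weights, i.e. $L(0)$-eigenvalues, need not be integers). It is a vertex operator algebra if all conformal weights are integers, the weight spaces $V_{(n)}$ are finite-dimensional, and $V_{(n)}=0$ for $n$ sufficiently negative. A weak $(V,\omega)$-module is a module for $V$ viewed as a vertex algebra. A lowest weight weak $(V,\omega)$-module is a weak module $W$ on which $L(0)$ acts semisimply such that $W=\bigoplus_{n\in\mathbb{N}}W_{(\lambda+n)}$ for some $\lambda\in\mathbb{C}$, where $W_{(\mu)}=\{w:L(0)w=\mu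 w\}$, and $W_{(\lambda)}$ is an irreducible $A(V,\omega)$-module (homogeneous $v$ acting as $v_{\mathrm{wt}\,v-1}$) which generates $W$ as a weak $V$-module. Here $A(V,\omega)$ is the Zhu algebra: the quotient of $V$ by the span of $\mathrm{Res}_x\frac{(1+x)^{\mathrm{wt}\,u}}{x^2}Y(u,x)v$ ($u$ homogeneous), with product induced by $u*v=\mathrm{Res}_x\frac{(1+x)^{\mathrm{wt}\,u}}{x}Y(u,x)v$. For a conformal vertex algebra $(V,\omega)$ and weak $V$-modules $W_1,W_2,W_3$, an intertwining operator (with respect to $\omega$) of type $\binom{W_3}{W_1W_2}$ is a linear map $I(\cdot,x):W_1\to(\mathrm{Hom}(W_2,W_3))\{x\}$, $I(w_1,x)=\sum_{\alpha\in\mathbb{C}}(w_1)_\alpha x^{-\alpha-1}$, such that for $w_1\in W_1,w_2\in W_2,\alpha\in\mathbb{C}$, $(w_1)_{\alpha+n}w_2=0$ for sufficiently large integers $n$; $$x_0^{-1}\delta\left(\tfrac{x_1-x_2}{x_0}\right)Y(v,x_1)I(w_1,x_2)w_2-x_0^{-1}\delta\left(\tfrac{x_2-x_1}{-x_0}\right)I(w_1,x_2)Y(v,x_1)w_2=x_2^{-1}\delta\left(\tfrac{x_1-x_0}{x_2}\right)I(Y(v,x_0)w_1,x_2)w_2$$ for $v\in V$; and $I(L(-1)w_1,x)=\frac{d}{dx}I(w_1,x)$ for $w_1\in W_1$, where $L(-1)=\omega_0$ acts on $W_1$. With respect to $\omega'$, the last axiom uses $L'(-1)=\omega'_0$ in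 place of $L(-1)$. *)

(* Defs.v *)
(* The base field is R[i] with R : realType, i.e. the complex numbers. *)
From HB Require Import structures.
From mathcomp Require Import all_boot all_order all_algebra.
From mathcomp Require Import boolp classical_sets functions fsbigop reals.
From mathcomp Require Import complex.

Set Implicit Arguments.
Unset Strict Implicit.
Unset Printing Implicit Defensive.

Import Order.TTheory GRing.Theory Num.Theory.

Local Open Scope classical_set_scope.
Local Open Scope ring_scope.

(* a (a - 1) ... (a - k + 1) / k! *)
Definition gbinom (F : fieldType) (a : F) (k : nat) : F :=
  (\prod_(j < k) (a - j%:R)) / k`!%:R.

Section JacobiIdentity.
Context {F : fieldType} {V W1 W2 W3 : lmodType F}.

(* The modes v_n of Y(v,x) = \sum_n v_n x^(-n-1) are written Y n v.
   This is the coefficient of x0^(-l-1) x1^(-m-1) x2^(-n-1) in the Jacobi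
   identity, applied to w2, where J n w1 is the coefficient of x2^(-n-1) in
   I(w1,x2) (up to a fixed complex shift of the exponents). Every (x - y)^l is
   expanded in nonnegative powers of y; on the right-hand side,
   x2^(-1) delta((x1 - x0)/x2) = \sum_m x1^(-m-1) (x2 + x0)^m.
   The sums over i have finite support whenever Y2, Y1 and J satisfy the
   truncation condition. *)
Definition jacobi_identity (Y1 : int -> V -> W1 -> W1)
    (Y2 : int -> V -> W2 -> W2) (Y3 : int -> V -> W3 -> W3)
    (J : int -> W1 -> W2 -> W3) : Prop :=
  forall (l m n : int) (v : V) (w1 : W1) (w2 : W2),
    (\sum_(i \in [set: nat])
        ((-1) ^+ i * gbinom l%:~R i)
          *: Y3 (m + l - i%:Z) v (J (n + i%:Z) w1 w2))
  - (\sum_(i \in [set: nat])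
        ((-1) ^ l * (-1) ^+ i * gbinom l%:~R i)
          *: J (n + l - i%:Z) w1 (Y2 (m + i%:Z) v w2))
  = \sum_(i \in [set: nat])
        gbinom m%:~R i *: J (m + n - i%:Z) (Y1 (l + i%:Z) v w1) w2.

End JacobiIdentity.

Definition truncated {F : fieldType} {W1 W2 W3 : lmodType F}
    (J : int -> W1 -> W2 -> W3) : Prop :=
  forall w1 w2, exists N : int, forall n, N <= n -> J n w1 w2 = 0.

Record vertexAlgebra (R : realType) := VertexAlgebra {
  va_sort :> lmodType R[i];
  va_vac : va_sort;
  va_Y : int -> va_sort -> va_sort -> va_sort;
  va_bilinear : forall n, bilinear_for *:%R *:%R (va_Y n);
  va_truncated : truncated va_Y;
  va_vacuum : forall n v, va_Y n va_vac v = (n == -1)%:R *: v;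
  va_creation : forall v, va_Y (-1) v va_vac = v;
  va_creation_reg : forall n v, 0 <= n -> va_Y n v va_vac = 0;
  va_jacobi : jacobi_identity va_Y va_Y va_Y va_Y }.

Record vaModule (R : realType) (V : vertexAlgebra R) := VAModule {
  mod_sort :> lmodType R[i];
  mod_Y : int -> V -> mod_sort -> mod_sort;
  mod_bilinear : forall n, bilinear_for *:%R *:%R (mod_Y n);
  mod_truncated : truncated mod_Y;
  mod_vacuum : forall n w, mod_Y n (va_vac V) w = (n == -1)%:R *: w;
  mod_jacobi : jacobi_identity (@va_Y R V) mod_Y mod_Y mod_Y }.

Section LinearAlgebra.
Context {F : fieldType} {W : lmodType F}.

Definition subspace (U : set W) : Prop :=
  U 0 /\ forall (a : F) u v, U u -> U v -> U (a *: u + v).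

Definition span (G : set W) : set W := smallest subspace G.

Definition eigenspace (f : W -> W) (mu : F) : set W :=
  [set w | f w = mu *: w].

Definition semisimple_op (f : W -> W) : Prop :=
  span (\bigcup_mu eigenspace f mu) = setT.

Definition finite_dim (U : set W) : Prop :=
  exists (d : nat) (b : 'I_d -> W), U = span (range b).

End LinearAlgebra.

Section Conformal.
Context {R : realType} {V : vertexAlgebra R}.
Implicit Types omega : V.

Local Notation Y := (@va_Y R V).

(* Y(omega,x) = \sum_n L(n) x^(-n-2), on V or on a module with modes Y. *)
Definition Lop {W : lmodType R[i]} (Y : int -> V -> W -> W) omega (n : int)
  : W -> W := Y (n + 1) omega.

Definition virasoro omega : Prop :=
  exists c : R[i], forall (m n : int) (v : V),
    Lop Y omega m (Lop Y omega n v) - Lop Y omega n (Lop Y omega m v)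
    = (m - n)%:~R *: Lop Y omega (m + n) v
      + ((m ^+ 3 - m)%:~R / 12%:R * (m + n == 0)%:R * c) *: v.

Definition conformal_vector omega : Prop :=
  [/\ virasoro omega,
      forall v, Lop Y omega (-1) v = Y (-2) v (va_vac V),
      semisimple_op (Lop Y omega 0)
    & forall (n : int), 1 <= n ->
        forall v, exists k : nat, iter k (Lop Y omega n) v = 0].

Definition weight_space {W : lmodType R[i]} (Y : int -> V -> W -> W) omega
  (mu : R[i]) : set W := eigenspace (Lop Y omega 0) mu.

Definition is_voa omega : Prop :=
  [/\ conformal_vector omega,
      forall (mu : R[i]) v, weight_space Y omega mu v -> v != 0 ->
        exists n : int, mu = n%:~R,
      forall n : int, finite_dim (weight_space Y omega n%:~R)
    & exists N : int, forall n : int, n < N ->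
        weight_space Y omega n%:~R = [set 0]].

(* Res_x (1+x)^mu / x^k Y(u,x) v *)
Definition zhu_res (mu : R[i]) (k : nat) (u v : V) : V :=
  \sum_(i \in [set: nat]) gbinom mu i *: Y (i%:Z - k%:Z) u v.

Definition zhu_O omega : set V :=
  span [set x | exists (mu : R[i]) (u v : V),
          weight_space Y omega mu u /\ x = zhu_res mu 2 u v].

(* M is a module for A(V,omega) = V / zhu_O omega, via rho : V -> End(M).
   By linearity in u, the product need only be tested on homogeneous u. *)
Definition zhu_module omega {W : lmodType R[i]} (M : set W)
    (rho : V -> W -> W) : Prop :=
  [/\ subspace M,
      forall u w, M w -> M (rho u w),
      (forall a u v w, M w -> rho (a *: u + v) w = a *: rho u w + rho v w)
        /\ (forall a u w w', M w -> M w' ->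
              rho u (a *: w + w') = a *: rho u w + rho u w'),
      forall u w, zhu_O omega u -> M w -> rho u w = 0
    & (forall w, M w -> rho (va_vac V) w = w)
        /\ (forall mu u v w, weight_space Y omega mu u -> M w ->
              rho (zhu_res mu 1 u v) w = rho u (rho v w))].

Definition zhu_irreducible omega {W : lmodType R[i]} (M : set W)
    (rho : V -> W -> W) : Prop :=
  [/\ zhu_module omega M rho, M <> [set 0]
    & forall U : set W, subspace U -> U `<=` M ->
        (forall v w, U w -> U (rho v w)) -> U = [set 0] \/ U = M].

Definition submodule (W : vaModule V) (U : set W) : Prop :=
  subspace U /\ forall n v w, U w -> U (mod_Y n v w).

(* (V,omega) is meant to be a vertex operator algebra, so that all weights of
   V are integers and v_(wt v - 1) makes sense for every homogeneous v. *)
Definition lowest_weight omega (W : vaModule V) : Prop :=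
  let YW := @mod_Y R V W in
  semisimple_op (Lop YW omega 0) /\
  exists lambda : R[i],
    [/\ forall w, exists (k : nat) (u : nat -> W),
          (forall n, weight_space YW omega (lambda + n%:R) (u n))
          /\ w = \sum_(n < k) u n,
        exists rho : V -> W -> W,
          (forall (n : int) v w, weight_space Y omega n%:~R v ->
             weight_space YW omega lambda w -> rho v w = YW (n - 1) v w)
          /\ zhu_irreducible omega (weight_space YW omega lambda) rho
      & forall U : set W, submodule U ->
          weight_space YW omega lambda `<=` U -> U = setT].

(* I alpha w1 = (w1)_alpha, where I(w1,x) = \sum_alpha (w1)_alpha x^(-alpha-1);
   the last condition is I(L(-1) w1, x) = d/dx I(w1,x) coefficientwise. *)
Definition intertwining omega (W1 W2 W3 : vaModule V)
    : set (R[i] -> W1 -> W2 -> W3) :=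
  [set I | [/\ forall alpha, bilinear_for *:%R *:%R (I alpha),
      forall alpha, truncated (fun n : int => I (alpha + n%:~R)),
      forall alpha, jacobi_identity (@mod_Y R V W1) (@mod_Y R V W2)
        (@mod_Y R V W3) (fun n : int => I (alpha + n%:~R))
    & forall alpha w1 w2,
        I alpha (Lop (@mod_Y R V W1) omega (-1) w1) w2
        = - alpha *: I (alpha - 1) w1 w2]].

Definition module_hom (W W' : vaModule V) (f : {linear W -> W'}) : Prop :=
  forall n v w, f (mod_Y n v w) = mod_Y n v (f w).

End Conformal.

Definition linear_iso {F : fieldType} {E E' : lmodType F}
    (S : set E) (S' : set E') (Phi : E -> E') : Prop :=
  set_bij S S' Phi /\
  forall a x y, S x -> S y -> Phi (a *: x + y) = a *: Phi x + Phi y.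

(* Main.v *)
Require Import Defs.
From HB Require Import structures.
From mathcomp Require Import all_boot all_order all_algebra.
From mathcomp Require Import boolp classical_sets functions cardinality fsbigop.
From mathcomp Require Import reals complex lra zify ring.

(** Put u = omega' - omega. Since L(-1) and L'(-1) both equal the canonical
    derivation D on V, the zero mode u_0 vanishes on V. The commutator formula
    [u_0, v_n] = (u_0 v)_n then says that on every weak module u_0 = L'(-1) - L(-1)
    commutes with all modes ([zero_mode_commute]), so it is an endomorphism of
    the module.

    On a lowest weight module W1 such an endomorphism is a scalar s
    ([lowest_weight_scalar]). It preserves the lowest weight space, which is an
    irreducible A(V)-module. V has countable dimension, being the sum of countably
    many finite-dimensional weight spaces, so Dixmier's form of Schur's lemma
    applies ([dixmier_schur]): over an uncountable algebraically closed field, an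
    operator T on a space of countable dimension cannot have T - c bijective
    for every c, since the vectors (T - c)^(-1) w would be linearly independent.
    So u_0 is a scalar on the lowest weight space, hence on the submodule that
    this space generates, which is W1.

    Thus L'(-1) = L(-1) + s on W1, and the isomorphism sends I(w1, x) to
    e^(s x) I(w1, x). The product makes sense because the modes of I vanish far up
    each coset of exponents. Multiplication by any power series in x2 preserves the
    Jacobi identity, all three terms of which are linear in I(., x2)
    ([psmul_jacobi]), and the product rule turns the L(-1)-derivative property into
    the one for L'(-1) ([psmul_exp_intertwining]). The inverse is
    multiplication by e^(- s x).

    For naturality: a module map f1 : U1 -> W1 intertwines the actions of u_0, so
    the scalars of U1 and W1 agree as soon as f1 has a nonzero value; where f1
    vanishes both sides are zero. *)

Set Implicit Arguments.
Unset Strict Implicit.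
Unset Printing Implicit Defensive.

Import Order.TTheory GRing.Theory Num.Theory.
Import Defs.

Local Open Scope classical_set_scope.
Local Open Scope ring_scope.

(** * Linear maps and spans *)

Lemma linear_map0 {F : fieldType} {U W : lmodType F} (f : U -> W) :
  linear f -> f 0 = 0.
Proof. by move=> /(_ (-1) 0 0); rewrite scaler0 addr0 scaleN1r addNr. Qed.

Lemma linear_mapZ {F : fieldType} {U W : lmodType F} (f : U -> W) a u :
  linear f -> f (a *: u) = a *: f u.
Proof. by move=> lin; rewrite -[a *: u]addr0 lin (linear_map0 lin) addr0. Qed.

Section Span.
Context {F : fieldType} {W : lmodType F}.

Lemma span_gen (G : set W) : G `<=` span G.
Proof. by move=> w Gw U [_]; apply. Qed.

Lemma subspace_span (G : set W) : subspace (span G).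
Proof.
split=> [U [[U0 _] _] //|a u v Gu Gv U [subU GU]].
by apply: subU.2; [apply: Gu | apply: Gv].
Qed.

Lemma span_subset (G U : set W) : subspace U -> G `<=` U -> span G `<=` U.
Proof. by move=> subU GU w; apply. Qed.

Lemma span_eq_setT (G : set W) (U : set W) :
  span G = setT -> subspace U -> G `<=` U -> forall w, U w.
Proof. by move=> GT subU GU w; apply: (span_subset subU GU); rewrite GT. Qed.

Lemma span_sequenceP (g : nat -> W) (w : W) : span (range g) w ->
  exists (k : nat) (a : nat -> F), w = \sum_(i < k) a i *: g i.
Proof.
set U := [set w | exists (k : nat) (a : nat -> F), w = \sum_(i < k) a i *: g i].
apply: (@span_subset _ U) => [|_ [j _ <-]]; last first.
  exists j.+1, (fun i => (i == j)%:R); rewrite big_ord_recr/= eqxx scale1r.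
  by rewrite big1 ?add0r// => i _; rewrite ltn_eqF// scale0r.
split=> [|c u v [k [a ->]] [l [b ->]]].
  by exists 0, (fun=> 0); rewrite big_ord0.
pose cut (m : nat) (e : nat -> F) i := if (i < m)%N then e i else 0.
have widen m (e : nat -> F) : (m <= k + l)%N ->
    \sum_(i < m) e i *: g i = \sum_(i < k + l) cut m e i *: g i.
  move=> le_m; rewrite (big_ord_widen _ (fun i => e i *: g i) le_m) big_mkcond.
  by apply: eq_bigr => i _; rewrite /cut; case: ifP; rewrite ?scale0r.
exists (k + l)%N, (fun i => c * cut k a i + cut l b i).
rewrite (widen k) ?leq_addr// (widen l) ?leq_addl// scaler_sumr -big_split.
by apply: eq_bigr => i _; rewrite scalerDl scalerA.
Qed.

End Span.

(** * Uncountability of the complex numbers *)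

Section Uncountable.
Context {R : realType}.

(** The outer third of the interval I on the side of its midpoint away from x. *)
Definition avoiding_third (x : R) (I : R * R) : R * R :=
  let: (a, b) := I in
  if x <= (a + b) / 2 then ((a + 2 * b) / 3, b) else (a, (2 * a + b) / 3).

Fixpoint nested_third (x : nat -> R) (n : nat) : R * R :=
  if n is n'.+1 then avoiding_third (x n') (nested_third x n') else (0, 1).

Lemma nested_thirdP x n (I := nested_third x n) (J := nested_third x n.+1) :
  [/\ J.1 < J.2, I.1 <= J.1, J.2 <= I.2 & ~~ (J.1 <= x n <= J.2)].
Proof.
have ltI : I.1 < I.2.
  rewrite /I; elim: n {I J} => /= [|n]; first exact: ltr01.
  case: (nested_third x n) => a b /= ab; rewrite /avoiding_third.
  by case: ifP => _ /=; lra.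
rewrite /J /= -/I; case: I ltI => a b /= ab; rewrite /avoiding_third.
case: (leP (x n)) => xab /=; split; try lra; apply/negP => /andP[]; lra.
Qed.

Lemma nested_third_mono x m n : (m <= n)%N ->
  (nested_third x m).1 <= (nested_third x n).1 /\
  (nested_third x n).2 <= (nested_third x m).2.
Proof.
elim: n => [|n IHn]; first by rewrite leqn0 => /eqP ->.
rewrite leq_eqVlt => /predU1P[-> //|/IHn[l r]].
have [_ l' r' _] := nested_thirdP x n.
by split; [exact: le_trans l' | exact: le_trans r].
Qed.

(** Cantor's nested intervals: the supremum of the left endpoints lies in every
    interval, while the n-th term of the sequence is outside the (n+1)-st. *)
Lemma sequence_misses_real (x : nat -> R) : exists r : R, forall n, x n != r.
Proof.
pose I := nested_third x.
have leI m n : (I m).1 <= (I n).2.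
  have [l _] := nested_third_mono x (leq_trans (leq_maxl m n) (leqnSn _)).
  have [_ r] := nested_third_mono x (leq_trans (leq_maxr m n) (leqnSn _)).
  have [lt_lr _ _ _] := nested_thirdP x (maxn m n).
  exact: le_trans (le_trans l (ltW lt_lr)) r.
pose E := [set (I n).1 | n in [set: nat]].
have supE : has_sup E.
  split; first by exists (I 0).1, 0.
  by exists (I 0).2 => _ [n _ <-].
exists (sup E) => n; have [_ _ _] := nested_thirdP x n.
apply: contraNneq => ->; apply/andP; split.
  by apply: ub_le_sup; [case: supE | exists n.+1].
apply: ge_sup; [by case: supE | move=> _ [m _ <-]; exact: (leI m n.+1)].
Qed.

Lemma complex_uncountable : ~ countable [set: R[i]].
Proof.
move=> /countable_injP[f /in2TT finj].
have [r rP] := sequence_misses_real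
  (fun n => xget 0 [set x : R | f x%:C%C = n]).
have /eqP := rP (f r%:C%C); apply; case: xgetP => [y _ /= /finj[]|/(_ r)]//.
by move=> /(_ erefl).
Qed.

(** If each value k were taken at most k times, all fibres would be finite and
    their countable union R[i] would be countable. The bound k is the one that
    makes k + 1 vectors in the span of k generators dependent. *)
Lemma complex_pigeonhole (f : R[i] -> nat) : exists (k : nat) (s : seq R[i]),
  [/\ uniq s, (k < size s)%N & forall c, c \in s -> f c = k].
Proof.
apply: contrapT => nex; apply: complex_uncountable.
rewrite (_ : setT = \bigcup_(k in setT) [set c | f c = k]); last first.
  by apply/seteqP; split=> // c _; exists (f c).
apply: bigcup_countable => // k _; apply: finite_set_countable.
apply: contrapT => /(@infinite_set_fset _ _ k.+1) [B Bf ltkB]; apply: nex.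
by exists k, (finmap.enum_fset B); split=> [||c /Bf]; first exact: finmap.fset_uniq.
Qed.

End Uncountable.

(** * Schur's lemma in countable dimension *)

Section PolynomialAction.
Context {F : fieldType} {W : lmodType F} (T : {linear W -> W}).

Definition poly_act (p : {poly F}) (w : W) : W :=
  \sum_(i < size p) p`_i *: iter i T w.

Lemma poly_act_widen n (p : {poly F}) w : (size p <= n)%N ->
  poly_act p w = \sum_(i < n) p`_i *: iter i T w.
Proof.
move=> pn; rewrite /poly_act (big_ord_widen n (fun i => p`_i *: iter i T w) pn).
rewrite big_mkcond; apply: eq_bigr => i _; case: ifPn => //.
by rewrite -leqNgt => /(nth_default _) ->; rewrite scale0r.
Qed.

Lemma poly_actD p q w : poly_act (p + q) w = poly_act p w + poly_act q w.
Proof.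
pose n := maxn (size p) (size q).
rewrite !(@poly_act_widen n) ?leq_maxl ?leq_maxr ?size_polyD//.
by rewrite -big_split; apply: eq_bigr => i _; rewrite coefD scalerDl.
Qed.

Lemma poly_actC c w : poly_act c%:P w = c *: w.
Proof. by rewrite (@poly_act_widen 1) ?size_polyC_leq1// big_ord1 coefC. Qed.

Lemma poly_actZ a p w : poly_act (a *: p) w = a *: poly_act p w.
Proof.
rewrite !(@poly_act_widen (size p)) ?size_scale_leq// scaler_sumr.
by apply: eq_bigr => i _; rewrite coefZ scalerA.
Qed.

Lemma poly_actXM p w : poly_act ('X * p) w = T (poly_act p w).
Proof.
rewrite (@poly_act_widen (size p).+1); last first.
  by rewrite (leq_trans (size_polyMleq _ _))// size_polyX addSn.
rewrite big_ord_recl coefXM scale0r add0r linear_sum.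
by apply: eq_bigr => i _; rewrite coefXM linearZ.
Qed.

Lemma poly_act_XsubC c p w :
  poly_act (('X - c%:P) * p) w = T (poly_act p w) - c *: poly_act p w.
Proof.
by rewrite mulrBl mul_polyC -scaleNr poly_actD poly_actXM poly_actZ scaleNr.
Qed.

End PolynomialAction.

Section Resolvent.
Context {F : closedFieldType} {W : lmodType F} (T : {linear W -> W}).
Context (M : set W) (w : W).
Hypotheses (subM : subspace M) (TM : forall m, M m -> M (T m)).
Hypothesis noeigen : forall c m, M m -> T m = c *: m -> m = 0.
Hypotheses (Mw : M w) (w0 : w != 0).

(** Over an algebraically closed field p(T) is a scalar times a product of operators
    T - c, each of which is injective on M. *)
Lemma poly_act_eq0 (p : {poly F}) : poly_act T p w = 0 -> p = 0.
Proof.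
have [rs ->] := closed_field_poly_normal p; rewrite poly_actZ => /eqP.
rewrite scaler_eq0 => /orP[/eqP ->|]; first by rewrite scale0r.
suff [_ /negPf ->] : M (poly_act T (\prod_(z <- rs) ('X - z%:P)) w) /\
    poly_act T (\prod_(z <- rs) ('X - z%:P)) w != 0 by [].
elim: rs => [|z rs [Mrs rs0]].
  by rewrite big_nil -[1]/(1%:P) poly_actC scale1r.
rewrite big_cons poly_act_XsubC; split.
  by rewrite addrC -scaleNr; apply: subM.2 => //; exact: TM.
by apply: contraNneq rs0 => /subr0_eq /(noeigen Mrs) ->.
Qed.

(** G c plays the role of (T - c)^(-1) w. Applying T - c0 to a relation
    among the G c turns the c0-term into a multiple of w and rescales the
    other coefficients by c - c0, so induction on the number of terms works once
    a term p(T) w is allowed in the relation. *)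
Lemma resolvents_free_poly (G : F -> W) (s : seq F) (a : F -> F) (p : {poly F}) :
    (forall c, T (G c) - c *: G c = w) -> uniq s ->
    \sum_(c <- s) a c *: G c + poly_act T p w = 0 ->
  forall c, c \in s -> a c = 0.
Proof.
move=> GP; elim: s p a => [//|c0 s IHs] p a /= /andP[c0s us] sum0.
have TG c : T (G c) = w + c *: G c by rewrite -(GP c) subrK.
pose q := ('X - c0%:P) * p + (\sum_(c <- c0 :: s) a c)%:P.
have qsum : \sum_(c <- s) (a c * (c - c0)) *: G c + poly_act T q w = 0.
  set S := (X in X = 0) in sum0.
  suff <- : T S - c0 *: S = \sum_(c <- s) (a c * (c - c0)) *: G c + poly_act T q w.
    by rewrite sum0 linear0 scaler0 subr0.
  have TaG c : T (a c *: G c) - c0 *: (a c *: G c) =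
      (a c * (c - c0)) *: G c + a c *: w.
    rewrite linearZ/= TG scalerDr !scalerA mulrBr scalerBl (mulrC c0).
    by rewrite -addrA addrC.
  rewrite /S linearD/= scalerDr opprD addrACA -poly_act_XsubC.
  rewrite linear_sum scaler_sumr -sumrB (eq_bigr _ (fun c _ => TaG c)).
  rewrite big_split -scaler_suml big_cons/= subrr mulr0 scale0r add0r.
  by rewrite /q poly_actD poly_actC -addrA; congr (_ + _); rewrite addrC.
have as0 c : c \in s -> a c = 0.
  move=> cs; have /eqP := IHs q _ us qsum c cs.
  rewrite mulf_eq0 subr_eq0 => /orP[/eqP //|/eqP cc0].
  by rewrite -cc0 cs in c0s.
move=> c; rewrite inE => /predU1P[->|]; last exact: as0.
(* only q(T) w is left, so q = 0; evaluating q at c0 isolates a c0 *)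
move: qsum; rewrite big1_seq ?add0r => [|d /andP[_ ds]]; last first.
  by rewrite as0// mul0r scale0r.
move=> /poly_act_eq0/(congr1 (horner^~ c0)).
rewrite /q big_cons (big1_seq _ _ _ (fun d ds => as0 d (andP ds).2))// addr0.
by rewrite !hornerE subrr mul0r add0r.
Qed.

Lemma resolvents_free (G : F -> W) (s : seq F) (a : F -> F) :
    (forall c, T (G c) - c *: G c = w) -> uniq s ->
  \sum_(c <- s) a c *: G c = 0 -> forall c, c \in s -> a c = 0.
Proof.
move=> GP us sum0; apply: (resolvents_free_poly (p := 0) GP us).
by rewrite sum0 add0r -polyC0 poly_actC scale0r.
Qed.
End Resolvent.

Section Schur.
Context {R : realType} {A W : lmodType R[i]} (T : {linear W -> W}) (M : set W).
Hypotheses (subM : subspace M) (TM : forall m, M m -> M (T m)).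

(** If T - c were bijective on M for every c, w would be the image of
    some L (v c) under each T - c. By pigeonhole more than n of the vectors v c lie,
    for some n, in the span of the first n generators of A, so they are dependent,
    against [resolvents_free]. *)
Lemma spectrum_nonempty (L : {linear A -> W}) (g : nat -> A) (w : W) :
    span (range g) = setT -> M w -> w != 0 -> M `<=` range L ->
  exists c : R[i], (exists m, [/\ M m, m != 0 & T m = c *: m]) \/
    (exists2 m, M m & forall m', M m' -> T m' - c *: m' <> m).
Proof.
move=> gV Mw w0 ML; apply: contrapT => nspec.
have noeigen c m : M m -> T m = c *: m -> m = 0.
  move=> Mm Tm; apply/eqP/negP => /negP m0; apply: nspec.
  by exists c; left; exists m.
have /choice[v vP] (c : R[i]) : exists v, T (L v) - c *: L v = w.
  apply: contrapT => nv; apply: nspec; exists c; right; exists w => // m.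
  by move=> /ML[v _ <-] TLv; apply: nv; exists v.
have /choice[k /choice[a va]] (c : R[i]) : exists k (a : nat -> R[i]),
    v c = \sum_(i < k) a i *: g i.
  by apply: span_sequenceP; rewrite gV.
have [n [s [us lt_ns ks]]] := complex_pigeonhole k.
pose B : 'M[R[i]]_(size s, n) := \matrix_(j, i) a s`_j i.
have /rowV0Pn[x /sub_kermxP xB x0] : kermx B != 0.
  rewrite -mxrank_eq0 mxrank_ker subn_eq0 -ltnNge.
  exact: leq_ltn_trans (rank_leq_col B) lt_ns.
pose b c := if insub (index c s) is Some j then x 0 j else 0.
have bE (j : 'I_(size s)) : b s`_j = x 0 j.
  by rewrite /b index_uniq// valK.
have vsE (j : 'I_(size s)) : v s`_j = \sum_(i < n) a s`_j i *: g i.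
  by rewrite va ks// mem_nth.
have sum0 : \sum_(c <- s) b c *: L (v c) = 0.
  rewrite (big_nth 0) big_mkord.
  under eq_bigr => j _ do rewrite bE vsE -linearZ/= scaler_sumr.
  rewrite -linear_sum exchange_big/= big1 ?linear0// => i _.
  under eq_bigr => j _ do rewrite scalerA.
  rewrite -scaler_suml; have /matrixP/(_ 0 i) := xB; rewrite !mxE => xBi.
  rewrite [X in X *: _](_ : _ = 0) ?scale0r// -[RHS]xBi.
  by apply: eq_bigr => j _; rewrite mxE.
move/eqP: x0; apply; apply/rowP => j; rewrite mxE -bE.
by apply: (resolvents_free subM TM noeigen Mw w0 vP us sum0); rewrite mem_nth.
Qed.

(** Cyclicity makes M a quotient of A, so some T - c is not bijective on M. Its
    kernel and its image on M are stable under rho. By irreducibility, if the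
    kernel is nonzero it is M, and if the image is not M it is 0: in both cases
    T = c on M. *)
Lemma dixmier_schur (rho : A -> W -> W) (g : nat -> A) :
    span (range g) = setT ->
    (forall v m, M m -> M (rho v m)) ->
    (forall a u v m, M m -> rho (a *: u + v) m = a *: rho u m + rho v m) ->
    (forall a v m m', M m -> M m' ->
       rho v (a *: m + m') = a *: rho v m + rho v m') ->
    (forall m, M m -> m != 0 -> M `<=` range (rho^~ m)) ->
    (forall v m, M m -> T (rho v m) = rho v (T m)) ->
    (forall U : set W, subspace U -> U `<=` M ->
       (forall v m, U m -> U (rho v m)) -> U = [set 0] \/ U = M) ->
  exists s : R[i], forall m, M m -> T m = s *: m.
Proof.
move=> gV Mrho rhoL rhoR cyc Trho irr.
have [M0 MD] := subM.
have [[w [Mw w0]]|nM] := pselect (exists w, M w /\ w != 0); last first.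
  exists 0 => m Mm; have [->|m0] := eqVneq m 0; first by rewrite linear0 scaler0.
  by case: nM; exists m.
pose L := rho^~ w.
have Llin : linear L by move=> a u v; exact: rhoL.
pose L' : {linear A -> W} := HB.pack L (GRing.isLinear.Build _ _ _ _ L Llin).
have [c []] := @spectrum_nonempty L' g w gV Mw w0 (cyc w Mw w0).
  move=> [m [Mm m0 Tm]]; exists c.
  pose U := [set m | M m /\ T m = c *: m].
  have [||v m' [Mm' Tm']|U0|UM] := irr U.
  - split=> [|a u v [Mu Tu] [Mv Tv]]; first by rewrite /U/= linear0 scaler0.
    by split; [exact: MD | rewrite linearP Tu Tv scalerDr !scalerA mulrC].
  - by move=> m' [].
  - split; [exact: Mrho | rewrite Trho// Tm'].
    have := rhoR c v m' 0 Mm' M0; rewrite addr0 => ->.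
    have := rhoR (-1) v 0 0 M0 M0; rewrite scaler0 addr0 scaleN1r addNr => ->.
    by rewrite addr0.
  - by have : U m by []; rewrite U0/= => m00; rewrite m00 eqxx in m0.
  - by move=> m'; rewrite -UM => -[].
move=> [m Mm nm]; exists c => m' Mm'.
pose U := [set T m - c *: m | m in M].
have [|_ [u Mu <-]|v _ [u Mu <-]|U0|UM] := irr U.
- split=> [|a _ _ [u Mu <-] [v Mv <-]].
    by exists 0; rewrite // linear0 scaler0 subr0.
  exists (a *: u + v); first exact: MD.
  rewrite linearP scalerDr scalerBr opprD addrACA !scalerA.
  by rewrite (mulrC c).
- by rewrite addrC -scaleNr; apply: MD => //; exact: TM.
- exists (rho v u); first exact: Mrho.
  by rewrite Trho// addrC -scaleNr -rhoR ?scaleNr 1?addrC//; exact: TM.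
- have : U (T m' - c *: m') by exists m'.
  by rewrite U0 => /subr0_eq.
- by move: Mm; rewrite -UM => -[m1 Mm1 /nm]; case.
Qed.

End Schur.

(** * Eventually zero sums *)

Section FormalSums.
Context {F : fieldType}.
Implicit Types U W : lmodType F.

Definition eventually_zero {W : nmodType} (X : nat -> W) : Prop :=
  exists N, forall k, (N <= k)%N -> X k = 0.

Lemma fsum_ord {W : nmodType} N (X : nat -> W) :
  (forall k, (N <= k)%N -> X k = 0) ->
  \sum_(k \in [set: nat]) X k = \sum_(k < N) X k.
Proof.
move=> XN; rewrite fsbig_ord; apply/esym/fsbig_widen => // k [_ /=] /negP.
by rewrite -leqNgt => /XN.
Qed.

Lemma fsumD {W : nmodType} (X Z : nat -> W) :
  eventually_zero X -> eventually_zero Z ->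
  \sum_(k \in [set: nat]) (X k + Z k) =
  \sum_(k \in [set: nat]) X k + \sum_(k \in [set: nat]) Z k.
Proof.
move=> [N XN] [N' ZN]; pose M := maxn N N'.
have XM k : (M <= k)%N -> X k = 0 by rewrite geq_max => /andP[/XN].
have ZM k : (M <= k)%N -> Z k = 0 by rewrite geq_max => /andP[_ /ZN].
rewrite (fsum_ord XM) (fsum_ord ZM) -big_split; apply: fsum_ord => k Mk.
by rewrite XM// ZM// addr0.
Qed.

Lemma fsum_linear U W (f : {linear U -> W}) (X : nat -> U) : eventually_zero X ->
  f (\sum_(k \in [set: nat]) X k) = \sum_(k \in [set: nat]) f (X k).
Proof.
move=> [N XN]; rewrite (fsum_ord XN) linear_sum; apply/esym/fsum_ord => k /XN ->.
exact: linear0.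
Qed.

Lemma fsum_exchange {W : nmodType} (X : nat -> nat -> W) :
    (exists N, forall i k, (N <= i)%N -> X i k = 0) ->
    (forall i, eventually_zero (X i)) ->
  \sum_(i \in [set: nat]) \sum_(k \in [set: nat]) X i k =
    \sum_(k \in [set: nat]) \sum_(i \in [set: nat]) X i k
  /\ eventually_zero (fun k => \sum_(i \in [set: nat]) X i k).
Proof.
move=> [N XN] /choice[M XM]; pose K := (\max_(i < N) M i)%N.
have XK i k : (K <= k)%N -> X i k = 0.
  have [/XN -> //|ltiN Kk] := leqP N i; apply: XM; apply: leq_trans Kk.
  exact: (leq_bigmax (Ordinal ltiN)).
have inner k : \sum_(i \in [set: nat]) X i k = \sum_(i < N) X i k.
  by apply: fsum_ord => i /XN.
split; last by exists K => k Kk; rewrite inner big1// => i _; rewrite XK.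
rewrite (@fsum_ord _ N) => [|i Ni]; last by rewrite fsbig1// => k _; exact: XN.
rewrite [RHS](@fsum_ord _ K) => [|k Kk]; last first.
  by rewrite fsbig1// => i _; exact: XK.
under eq_bigr => i _ do rewrite (fsum_ord (XK i)).
by rewrite exchange_big; apply: eq_bigr => k _; rewrite inner.
Qed.

Lemma eventually_zeroZ W (c : nat -> F) (X : nat -> W) :
  eventually_zero X -> eventually_zero (fun k => c k *: X k).
Proof. by move=> [N XN]; exists N => k /XN ->; rewrite scaler0. Qed.

(** The form in which a term of the Jacobi identity commutes with multiplication by
    a power series: a, g are the coefficients and operators of that term, c the
    coefficients of the series. *)
Lemma fsum_exchange_linear U W (g : nat -> {linear U -> W})
    (a c : nat -> F) (X : nat -> nat -> U) :
    (exists N, forall i k, (N <= i)%N -> g i (X i k) = 0) ->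
    (forall i, eventually_zero (X i)) ->
  \sum_(i \in [set: nat]) a i *: g i (\sum_(k \in [set: nat]) c k *: X i k) =
    \sum_(k \in [set: nat]) c k *: \sum_(i \in [set: nat]) a i *: g i (X i k)
  /\ eventually_zero
       (fun k => c k *: \sum_(i \in [set: nat]) a i *: g i (X i k)).
Proof.
move=> [N gN] X0.
have inner k : c k *: (\sum_(i \in [set: nat]) a i *: g i (X i k)) =
    \sum_(i \in [set: nat]) c k *: (a i *: g i (X i k)).
  apply: (fsum_linear (GRing.scale (c k))).
  by exists N => i /gN ->; rewrite scaler0.
have outer i : a i *: g i (\sum_(k \in [set: nat]) c k *: X i k) =
    \sum_(k \in [set: nat]) c k *: (a i *: g i (X i k)).
  have Xi0 := eventually_zeroZ c (X0 i).
  have /= -> := fsum_linear (GRing.scale (a i) \o g i) Xi0.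
  by apply: eq_fsbigr => k _; rewrite /= linearZ/= !scalerA mulrC.
have [||eq0 ev0] := @fsum_exchange _ (fun i k => c k *: (a i *: g i (X i k))).
- by exists N => i k /gN ->; rewrite !scaler0.
- move=> i; have [M XM] := X0 i; exists M => k /XM ->.
  by rewrite linear0 !scaler0.
split.
  by under eq_fsbigr do rewrite outer; under [RHS]eq_fsbigr do rewrite inner.
by move: ev0; under [in X in X -> _]eq_fun do rewrite -inner.
Qed.

End FormalSums.

(** * Multiplication of formal series by power series *)

Section SeriesMul.
Context {F : fieldType} {W1 W2 W3 : lmodType F}.

(** In terms of J(w1, x) = \sum_n J n w1 w2 x^(-n-1), this is multiplication by
    the power series \sum_k c k x^k. The index type K is int for one coset of
    exponents and the field F for all of them. *)
Definition psmul {K : nzRingType} (c : nat -> F) (J : K -> W1 -> W2 -> W3)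
    (n : K) (w1 : W1) (w2 : W2) : W3 :=
  \sum_(k \in [set: nat]) c k *: J (n + k%:R) w1 w2.

Lemma truncated_eventually (J : int -> W1 -> W2 -> W3) n w1 w2 : truncated J ->
  eventually_zero (fun k : nat => J (n + k%:R) w1 w2).
Proof.
move=> /(_ w1 w2)[N JN]; exists `|N - n|%N => k lek; apply: JN; lia.
Qed.

Lemma psmul_int (c : nat -> F) (I : F -> W1 -> W2 -> W3) (alpha : F) :
  (fun n : int => psmul c I (alpha + n%:~R)) =
  psmul c (fun n : int => I (alpha + n%:~R)).
Proof.
apply/funext => n; apply/funext => w1; apply/funext => w2.
by apply: eq_fsbigr => k _; rewrite intrD addrA natz.
Qed.

Lemma psmul_truncated c (J : int -> W1 -> W2 -> W3) :
  truncated J -> truncated (psmul c J).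
Proof.
move=> trJ w1 w2; have [N JN] := trJ w1 w2; exists N => n Nn.
by rewrite /psmul fsbig1// => k _; rewrite JN ?scaler0//; lia.
Qed.

(** Each of the three terms is linear in J and gets multiplied by c(x2) when J does,
    so the identity at n for the product is the combination with coefficients c k
    of the identities at n + k for J. *)
Lemma psmul_jacobi {V : lmodType F} c (Y1 : int -> V -> W1 -> W1)
    (Y2 : int -> V -> W2 -> W2) (Y3 : int -> V -> W3 -> W3)
    (J : int -> W1 -> W2 -> W3) :
    truncated Y1 -> truncated Y2 -> (forall n v, linear (Y3 n v)) ->
    truncated J -> (forall n, bilinear_for *:%R *:%R (J n)) ->
  jacobi_identity Y1 Y2 Y3 J -> jacobi_identity Y1 Y2 Y3 (psmul c J).
Proof.
move=> tr1 tr2 lin3 trJ linJ jacJ l m n v w1 w2.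
have ev n' w w' := truncated_eventually n' w w' trJ.
pose Y3lin k : {linear W3 -> W3} :=
  HB.pack (Y3 k v) (GRing.isLinear.Build _ _ _ _ (Y3 k v) (lin3 k v)).
(* beyond N the inner modes vanish because of truncation: of J here, and of
   Y2 and Y1 in the two other terms *)
have [||-> ev1] := fsum_exchange_linear (g := fun i => Y3lin (m + l - i%:Z))
  (fun i => (-1) ^+ i * gbinom l%:~R i) c
  (X := fun i k => J (n + i%:Z + k%:R) w1 w2).
- have [N JN] := trJ w1 w2; exists `|N - n|%N => i k lei.
  by rewrite JN ?linear0//; lia.
- by move=> i; exact: ev.
have [||-> ev2] := fsum_exchange_linear (g := fun=> idfun)
  (fun i => (-1) ^ l * (-1) ^+ i * gbinom l%:~R i) c
  (X := fun i k => J (n + l - i%:Z + k%:R) w1 (Y2 (m + i%:Z) v w2)).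
- have [N YN] := tr2 v w2; exists `|N - m|%N => i k lei.
  by rewrite /= YN ?(linear_map0 ((linJ _).2 _))//; lia.
- by move=> i; exact: ev.
have [||-> ev3] := fsum_exchange_linear (g := fun=> idfun)
  (fun i => gbinom m%:~R i) c
  (X := fun i k => J (m + n - i%:Z + k%:R) (Y1 (l + i%:Z) v w1) w2).
- have [N YN] := tr1 v w1; exists `|N - l|%N => i k lei.
  by rewrite /= YN ?(linear_map0 ((linJ _).1 _))//; lia.
- by move=> i; exact: ev.
rewrite (fsum_linear -%R ev2) -fsumD//; last first.
  by have [N evN] := ev2; exists N => k /evN ->; rewrite linear0.
apply: eq_fsbigr => k _; rewrite -scalerBr; congr (_ *: _).
rewrite [RHS](_ : _ = \sum_(i \in [set: nat])
  gbinom m%:~R i *: J (m + (n + k%:R) - i%:Z) (Y1 (l + i%:Z) v w1) w2).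
  rewrite -jacJ; congr (_ - _); apply: eq_fsbigr => i _ /=.
    by rewrite (addrAC n).
  by rewrite -!addrA [k%:R + _]addrC -!addrA.
by apply: eq_fsbigr => i _; rewrite -!addrA [k%:R + _]addrC.
Qed.

Lemma psmul_comp c d (J : int -> W1 -> W2 -> W3) (n : int) w1 w2 : truncated J ->
  psmul c (psmul d J) n w1 w2 =
  psmul (fun k => \sum_(j < k.+1) c j * d (k - j)%N) J n w1 w2.
Proof.
move=> trJ; have [N JN] := truncated_eventually n w1 w2 trJ.
rewrite /psmul (@fsum_ord _ N) => [|k Nk]; last first.
  rewrite fsbig1 ?scaler0// => j _; rewrite -addrA -natrD JN ?scaler0//.
  exact: leq_trans (leq_addr _ _).
rewrite (@fsum_ord _ N) => [|k Nk]; last by rewrite JN ?scaler0.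
pose G j k := (c j * d (k - j)%N) *: J (n + k%:R) w1 w2.
(* k stands for the total degree j + (k - j) *)
transitivity (\sum_(j < N) \sum_(k < N | (j <= k)%N) G j k).
  apply: eq_bigr => j _.
  have -> : \sum_(k < N | (j <= k)%N) G j k = \sum_(j <= k < N) G j k.
    by rewrite (big_nat_widenl j 0)// big_mkord.
  have -> : \sum_(j <= k < N) G j k = \sum_(0 + j <= k < N) G j k by rewrite add0n.
  rewrite big_addn big_mkord.
  rewrite (@fsum_ord _ (N - j)%N) => [|k]; last first.
    rewrite leq_subLR addnC => leNk; rewrite -addrA -natrD.
    by rewrite addnC JN ?scaler0.
  rewrite scaler_sumr; apply: eq_bigr => k _.
  by rewrite /G addnK addnC natrD addrA scalerA.
rewrite (exchange_big_dep xpredT)//=; apply: eq_bigr => k _.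
rewrite (big_ord_widen_cond N xpredT (fun j => c j * d (k - j)%N))//.
rewrite scaler_suml; apply: eq_big => // j.
Qed.
End SeriesMul.

Section CosetSeries.
Context {F : fieldType} {W1 W2 W3 : lmodType F}.
Implicit Type I : F -> W1 -> W2 -> W3.

(** Multiplication of I by a power series is well defined under this condition. *)
Definition coset_truncated I :=
  forall alpha, truncated (fun n : int => I (alpha + n%:~R)).

Lemma coset_truncated_eventually I alpha w1 w2 :
  coset_truncated I -> eventually_zero (fun k => I (alpha + k%:R) w1 w2).
Proof.
move=> trI; have [N IN] := truncated_eventually 0 w1 w2 (trI alpha).
by exists N => k /IN; rewrite add0r natz.
Qed.

Lemma psmul_linear_comb {U1 U2 : lmodType F} c (I : F -> U1 -> U2 -> W3)
    (I' I'' : F -> W1 -> W2 -> W3) a alpha u1 u2 w1 w2 w1' w2' :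
    coset_truncated I' -> coset_truncated I'' ->
    (forall k : nat, I (alpha + k%:R) u1 u2 =
       a *: I' (alpha + k%:R) w1 w2 + I'' (alpha + k%:R) w1' w2') ->
  psmul c I alpha u1 u2 = a *: psmul c I' alpha w1 w2 + psmul c I'' alpha w1' w2'.
Proof.
move=> tr' tr'' IE.
have ev' := eventually_zeroZ c (coset_truncated_eventually alpha w1 w2 tr').
have ev'' := eventually_zeroZ c (coset_truncated_eventually alpha w1' w2' tr'').
rewrite /psmul (fsum_linear (GRing.scale a) ev') -fsumD//; last first.
  exact: eventually_zeroZ (fun=> a) _ ev'.
by apply: eq_fsbigr => k _; rewrite IE scalerDr /= !scalerA mulrC.
Qed.

Lemma psmul_bilinear c I :
    coset_truncated I -> (forall alpha, bilinear_for *:%R *:%R (I alpha)) ->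
  forall alpha, bilinear_for *:%R *:%R (psmul c I alpha).
Proof.
move=> trI linI alpha; split=> w a u v; apply: psmul_linear_comb => // k.
  exact: (linI _).1.
exact: (linI _).2.
Qed.

Lemma psmul_comp_coset c d I alpha w1 w2 : coset_truncated I ->
  psmul c (psmul d I) alpha w1 w2 =
  psmul (fun k => \sum_(j < k.+1) c j * d (k - j)%N) I alpha w1 w2.
Proof.
move=> trI; have := psmul_comp c d 0 w1 w2 (trI alpha).
by rewrite -!psmul_int addr0.
Qed.
End CosetSeries.

(** * The scalar by which L'(-1) - L(-1) acts *)

Section ZeroMode.
Context {R : realType} {V : vertexAlgebra R}.
Implicit Types (omega : V) (W : vaModule V).

Lemma mod_linearr W n v : linear (@mod_Y R V W n v).
Proof. exact: (mod_bilinear W n).2. Qed.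

Lemma mod_linearl W n w : linear ((@mod_Y R V W n)^~ w).
Proof. exact: (mod_bilinear W n).1. Qed.

(** A copy of [mod_Y] with the mode and the vector as parameters, to carry the
    linear structure in the last argument. *)
Definition mode W (n : int) (v : V) : W -> W := mod_Y n v.
HB.instance Definition _ W n v :=
  GRing.isLinear.Build _ _ _ _ (@mode W n v) (@mod_linearr W n v).

(** The Jacobi identity with l = m = 0 is the commutator formula
    [u_0, v_n] = (u_0 v)_n. *)
Lemma zero_mode_commute W (u : V) : (forall v, va_Y 0 u v = 0) ->
  forall n v (w : W), mod_Y 0 u (mod_Y n v w) = mod_Y n v (mod_Y 0 u w).
Proof.
move=> u0 n v w; have := @mod_jacobi R V W 0 0 n u v w.
have g0 i : gbinom (0%:~R : R[i]) i = (i == 0)%:R.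
  case: i => [|i]; rewrite /gbinom ?big_ord0 ?fact0 ?divr1//.
  by rewrite big_ord_recl/= subrr mul0r mul0r.
have sum0 (c : nat -> R[i]) (X : nat -> W) : (forall i, c i.+1 = 0) ->
    \sum_(i \in [set: nat]) c i *: X i = c 0 *: X 0.
  move=> c0; rewrite (@fsum_ord _ 1) ?big_ord1// => -[//|i] _.
  by rewrite c0 scale0r.
rewrite !sum0 => [|i|i|i]; rewrite ?g0 ?mulr0//.
rewrite expr0z expr0 !mulr1 !scale1r !(addr0, add0r, subr0).
by rewrite u0 (linear_map0 (mod_linearl _ _)) => /subr0_eq.
Qed.

(** Both omega_0 and omega'_0 are the derivation v |-> v_(-2) 1 of V. *)
Lemma conformal_zero_mode omega omega' :
  conformal_vector omega -> conformal_vector omega' ->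
  forall v, va_Y 0 (omega' - omega) v = 0.
Proof.
move=> [_ D _ _] [_ D' _ _] v.
have := (va_bilinear V 0).1 v (-1) omega omega'.
rewrite /= !scaleN1r [- omega + _]addrC => ->.
by move: (D v) (D' v); rewrite /Lop addNr => -> ->; rewrite addNr.
Qed.

Lemma voa_countably_spanned omega : is_voa omega ->
  exists g : nat -> V, span (range g) = setT.
Proof.
move=> [[_ _ ss _] wtZ fin _].
have /choice[h hP] (n : int) : exists h : nat -> V,
    weight_space (@va_Y R V) omega n%:~R `<=` span (range h).
  have [d [b ->]] := fin n.
  exists (fun i => if insub i is Some j then b j else 0).
  apply: span_subset (subspace_span _) _ => _ [j _ <-].
  by apply: span_gen; exists (val j) => //; rewrite valK.
pose g j := if unpickle j is Some (n, i) then h n i else 0.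
exists g; apply/seteqP; split=> // v _.
apply: (span_eq_setT ss (subspace_span _)) => {}v [mu _ /= vmu].
have [->|v0] := eqVneq v 0; first exact: (subspace_span _).1.
have [n nE] := wtZ mu v vmu v0; rewrite nE in vmu.
apply: (span_subset (subspace_span _) _ (hP n v vmu)) => _ [i _ <-].
by apply: span_gen; exists (pickle (n, i)) => //; rewrite /g pickleK.
Qed.

(** The A(V)-orbit of m is stable because rho y (rho x m) = rho (y * x) m for
    homogeneous y, and homogeneous vectors span V. *)
Lemma zhu_irreducible_cyclic omega W (M : set W) (rho : V -> W -> W) m :
  semisimple_op (Lop (@va_Y R V) omega 0) -> zhu_irreducible omega M rho ->
  M m -> m != 0 -> M `<=` range (rho^~ m).
Proof.
move=> ss [[subM Mrho [rhoL rhoR] _ [rho1 rhoM]] _ irr] Mm m0.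
have subU : subspace (range (rho^~ m)).
  split=> [|a _ _ [x _ <-] [y _ <-]].
    exists 0 => //; have := rhoL (-1) 0 0 m Mm.
    by rewrite scaler0 addr0 scaleN1r addNr.
  by exists (a *: x + y); rewrite ?rhoL.
have [|v _ [x _ <-]|U0|<- //] := irr _ subU.
- by move=> _ [x _ <-]; exact: Mrho.
- pose P := [set y | forall x, range (rho^~ m) (rho y (rho x m))].
  apply: (span_eq_setT ss (U := P) _ _ v x) => [|y [mu _ ymu] z].
    split=> [z|a y y' Py Py' z].
      have := rhoL (-1) 0 0 _ (Mrho z m Mm).
      by rewrite scaler0 addr0 scaleN1r addNr => ->; exact: subU.1.
    by rewrite rhoL; [exact: subU.2 | exact: Mrho].
  by rewrite -(rhoM mu)//; exists (zhu_res mu 1 y z).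
- have : range (rho^~ m) m by exists (va_vac V) => //; exact: rho1.
  by rewrite U0/= => mE; rewrite mE eqxx in m0.
Qed.

(** u_0 commutes with L(0), so it preserves the lowest weight space M, and there it
    commutes with the action of A(V); Schur's lemma makes it a scalar s on M. The
    kernel of u_0 - s is a submodule containing M, hence all of W. *)
Lemma lowest_weight_scalar omega omega' W :
    is_voa omega -> conformal_vector omega' -> lowest_weight omega W ->
  exists s : R[i], forall w : W, mod_Y 0 omega' w = mod_Y 0 omega w + s *: w.
Proof.
move=> voa conf' [_ [lambda [_ [rho [rhoE irr]] gen]]].
have [conf wtZ _ _] := voa; have [_ _ ss _] := conf.
have [g gV] := voa_countably_spanned voa.
have [T [TE TY]] : exists T : {linear W -> W},
    (forall w, T w = mod_Y 0 (omega' - omega) w) /\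
    (forall n v w, T (mod_Y n v w) = mod_Y n v (T w)).
  exists (@mode W 0 (omega' - omega)); split=> //.
  exact: zero_mode_commute (conformal_zero_mode conf conf').
set M := weight_space (@mod_Y R V W) omega lambda in rhoE irr gen.
have irr' := irr; case: irr' => [[subM Mrho [rhoL rhoR] _ _] _ irrM].
have TM m : M m -> M (T m).
  by rewrite /M /weight_space /eigenspace/= /Lop -TY => ->; rewrite linearZ.
have Trho v m : M m -> T (rho v m) = rho v (T m).
  move: m; pose P := [set v | forall m, M m -> T (rho v m) = rho v (T m)].
  have rho0 m : M m -> rho 0 m = 0.
    move=> Mm; have := rhoL (-1) 0 0 m Mm.
    by rewrite scaler0 addr0 scaleN1r addNr.
  apply: (span_eq_setT ss (U := P)) => [|{}v [mu _ vmu] m Mm].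
    split=> [m Mm|a x y Px Py m Mm]; first by rewrite !rho0 ?linear0//; exact: TM.
    by rewrite !rhoL ?linearP ?Px ?Py//; exact: TM.
  have [->|v0] := eqVneq v 0; first by rewrite !rho0 ?linear0//; exact: TM.
  have [n nE] := wtZ mu v vmu v0; rewrite nE in vmu.
  by rewrite (rhoE n v m)// TY -(rhoE n v)//; exact: TM.
have [s sM] := dixmier_schur subM TM gV (fun v m => Mrho v m) rhoL rhoR
  (fun m => zhu_irreducible_cyclic ss irr) Trho irrM.
exists s => w; pose U := [set w | T w = s *: w].
have Uw : U w.
  rewrite (_ : U = setT)//; apply: gen => //; split.
    split=> [|a x y]; first by rewrite /U/= linear0 scaler0.
    by rewrite /U/= linearP => -> ->; rewrite scalerDr !scalerA mulrC.
  by move=> n v x; rewrite /U/= TY => ->; exact: linear_mapZ (mod_linearr _ _).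
have := mod_linearl 0 w 1 (omega' - omega) omega.
by rewrite /= !scale1r subrK -TE Uw addrC.
Qed.

End ZeroMode.

(** * Twisting intertwining operators by an exponential *)

Section Exponential.
Context {R : realType}.
Implicit Types s t : R[i].

Definition exp_coef s (k : nat) : R[i] := s ^+ k / k`!%:R.

Lemma exp_coef0 k : exp_coef 0 k = (k == 0)%:R.
Proof.
by rewrite /exp_coef expr0n; case: k => [|k]; rewrite ?mul0r// fact0 divr1.
Qed.

(** The differential equation of e^(s x), coefficientwise. *)
Lemma exp_coefS s k : k.+1%:R * exp_coef s k.+1 = s * exp_coef s k.
Proof.
rewrite /exp_coef factS natrM exprS; field.
by rewrite nat1r !pnatr_eq0 -lt0n fact_gt0.
Qed.

(** e^(s x) e^(t x) = e^((s + t) x), coefficientwise. *)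
Lemma exp_coefD s t k :
  \sum_(j < k.+1) exp_coef s j * exp_coef t (k - j)%N = exp_coef (s + t) k.
Proof.
rewrite /exp_coef addrC exprDn mulr_suml; apply: eq_bigr => j _.
have le_jk : (j <= k)%N by rewrite -ltnS.
rewrite -(bin_fact le_jk) !natrM -mulr_natr; field.
by rewrite !pnatr_eq0 -!lt0n !fact_gt0 bin_gt0.
Qed.

End Exponential.

Section Twist.
Context {R : realType} {V : vertexAlgebra R}.
Implicit Type omega : V.

Lemma psmul_expK s (W1 W2 W3 : vaModule V) (I : R[i] -> W1 -> W2 -> W3) :
  coset_truncated I -> psmul (exp_coef (- s)) (psmul (exp_coef s) I) = I.
Proof.
move=> trI; apply/funext => alpha; apply/funext => w1; apply/funext => w2.
rewrite psmul_comp_coset//; under eq_fun do rewrite exp_coefD addNr exp_coef0.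
rewrite /psmul (@fsum_ord _ 1) => [|[|k]//]; last by rewrite scale0r.
by rewrite big_ord1 scale1r addr0.
Qed.

(** The product rule: d/dx (e^(s x) I(w1, x)) = e^(s x) I((L(-1) + s) w1, x).
    Coefficientwise the term coming from the derivative of e^(s x) and
    the term coming from the scalar s cancel by telescoping. *)
Lemma psmul_exp_intertwining omega omega' s (W1 W2 W3 : vaModule V)
    (I : R[i] -> W1 -> W2 -> W3) :
    (forall w : W1, mod_Y 0 omega' w = mod_Y 0 omega w + s *: w) ->
  @intertwining R V omega W1 W2 W3 I ->
  @intertwining R V omega' W1 W2 W3 (psmul (exp_coef s) I).
Proof.
move=> omegaE [linI trI jacI derI].
split=> [|alpha|alpha|alpha w1 w2].
- exact: psmul_bilinear.
- by rewrite psmul_int; apply: psmul_truncated.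
- rewrite psmul_int; apply: psmul_jacobi; rewrite //.
  + exact: mod_truncated.
  + exact: mod_truncated.
  + exact: mod_linearr.
have [N IN] := coset_truncated_eventually (alpha - 1) w1 w2 trI.
pose f k := (k%:R * exp_coef s k) *: I (alpha - 1 + k%:R) w1 w2.
have step k :
    exp_coef s k *: I (alpha + k%:R) (Lop (@mod_Y R V W1) omega' (-1) w1) w2 =
    - alpha *: (exp_coef s k *: I (alpha - 1 + k%:R) w1 w2) - f k + f k.+1.
  rewrite /Lop addNr omegaE [w in I _ w]addrC (linI _).1 derI.
  rewrite scalerDr addrC; congr (_ + _); last first.
    by rewrite /f exp_coefS scalerA mulrC -[k.+1]add1n natrD addrA subrK.
  rewrite /f !scalerA -scalerBl addrAC; congr (_ *: _); ring.
rewrite /psmul (@fsum_ord _ N) => [|k Nk]; last first.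
  by rewrite step /f !IN ?leqW// !scaler0 subr0 addr0.
rewrite (@fsum_ord _ N) => [|k Nk]; last by rewrite IN ?scaler0.
under eq_bigr => k _ do rewrite step -addrA [- f k + _]addrC.
rewrite big_split/= -scaler_sumr.
rewrite -(big_mkord xpredT (fun k => f k.+1 - f k)) telescope_sumr//.
by rewrite /f IN// scaler0 mul0r scale0r subr0 addr0.
Qed.

End Twist.

(** * The isomorphism *)

(* The isomorphism is canonical in the sense that it can be chosen naturally in
   W1, W2 and W3. *)
Theorem proposition4p6 (R : realType) (V : vertexAlgebra R) (omega omega' : V)
    (Vvoa : is_voa omega) (conf' : conformal_vector omega') :
  exists Phi : forall W1 W2 W3 : vaModule V,
      (R[i] -> W1 -> W2 -> W3) -> (R[i] -> W1 -> W2 -> W3),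
    (forall W1 W2 W3 : vaModule V, lowest_weight omega W1 ->
       linear_iso (@intertwining R V omega W1 W2 W3)
                  (@intertwining R V omega' W1 W2 W3) (Phi W1 W2 W3))
    /\
    (forall (W1 W2 W3 U1 U2 U3 : vaModule V)
        (f1 : {linear U1 -> W1}) (f2 : {linear U2 -> W2})
        (f3 : {linear W3 -> U3}),
       lowest_weight omega W1 -> lowest_weight omega U1 ->
       module_hom f1 -> module_hom f2 -> module_hom f3 ->
       forall I, @intertwining R V omega W1 W2 W3 I ->
         Phi U1 U2 U3 (fun alpha u1 u2 => f3 (I alpha (f1 u1) (f2 u2)))
         = (fun alpha u1 u2 => f3 (Phi W1 W2 W3 I alpha (f1 u1) (f2 u2)))).
Proof.
(* the scalar by which omega'_0 - omega_0 acts on W *)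
pose gap (W : vaModule V) : R[i] := xget 0
  [set s | forall w : W, mod_Y 0 omega' w = mod_Y 0 omega w + s *: w].
have gapP W : lowest_weight omega W -> forall w : W,
    mod_Y 0 omega' w = mod_Y 0 omega w + gap W *: w.
  move=> lw; rewrite /gap; case: xgetP => [s _ //|no].
  by have [s /no] := lowest_weight_scalar Vvoa conf' lw.
exists (fun W1 W2 W3 => psmul (exp_coef (gap W1))).
split=> [W1 W2 W3 lw|W1 W2 W3 U1 U2 U3 f1 f2 f3 lwW lwU hom1 hom2 hom3 I intI].
  have gapN (w : W1) : mod_Y 0 omega w = mod_Y 0 omega' w + (- gap W1) *: w.
    by rewrite gapP// scaleNr addrK.
  split; last first.
    move=> a I J [_ trI _ _] [_ trJ _ _].
    apply/funext => alpha; apply/funext => w1; apply/funext => w2.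
    exact: psmul_linear_comb.
  split=> [I|I J|J intJ].
  - exact: psmul_exp_intertwining (gapP _ lw).
  - rewrite !inE => -[_ trI _ _] [_ trJ _ _] IJ.
    by rewrite -(psmul_expK (gap W1) trI) IJ psmul_expK.
  - exists (psmul (exp_coef (- gap W1)) J).
      exact: psmul_exp_intertwining gapN _.
    have [_ trJ _ _] := intJ.
    by rewrite -[X in exp_coef X]opprK psmul_expK.
have [linI trI _ _] := intI.
apply/funext => alpha; apply/funext => u1; apply/funext => u2.
have := fsum_linear f3 (eventually_zeroZ (exp_coef (gap W1))
  (coset_truncated_eventually alpha (f1 u1) (f2 u2) trI)).
rewrite /psmul => ->; apply: eq_fsbigr => k _; rewrite linearZ/=.
have [f1u0|f1u] := eqVneq (f1 u1) 0.
  by rewrite f1u0 (linear_map0 ((linI _).1 _)) linear0 !scaler0.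
suff -> : gap U1 = gap W1 by [].
apply/eqP; rewrite -subr_eq0; have := gapP W1 lwW (f1 u1).
rewrite -!hom1 gapP// linearD linearZ/= => /addrI/eqP.
by rewrite -subr_eq0 -scalerBl scaler_eq0 (negPf f1u) orbF.
Qed.
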